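(* There is a universal constant $c>0$ such that the following holds. Let $x$ be an $(M,\gamma)$-Ising model on $\{\pm1\}^m$. Then, for any vector $a\in\mathbb{R}^m$, $$\mathrm{Var}(a^\top x)\ge\frac{c\gamma^2\|a\|_2^2}{M}.$$
   Context: An Ising model with interaction matrix $J$ (real, symmetric, zero diagonal) and external field $h\in\mathbb{R}^m$ is the distribution on $\{\pm1\}^m$ with $\Pr[x]\propto\exp(x^\top Jx/2+h^\top x)$. For $M,\gamma>0$, a random vector $x$ is an $(M,\gamma)$-Ising model if it follows an Ising model with interaction matrix $J$ and some external field $h$ such that $\|J\|_\infty=\max_i\sum_j|J_{ij}|\le M$ and $\min_i\mathrm{Var}(x_i\mid x_{-i})\ge\gamma$ with probability $1$, where $x_{-i}$ denotes all coordinates except the $i$-th.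
   Formalization: The assumption γ ≤ M is added: without it the claim fails, e.g. for m = 1, J = 0, h = 0, where x is an (M,1)-Ising model for every M > 0 and Var(x) = 1, while c/M is unbounded as M → 0. *)

(* Defs.v *)
From mathcomp Require Import all_boot all_order all_algebra.
From mathcomp Require Import all_classical all_reals all_analysis.

Set Implicit Arguments.
Unset Strict Implicit.
Unset Printing Implicit Defensive.

Import Order.TTheory GRing.Theory Num.Theory.

Local Open Scope classical_set_scope.
Local Open Scope ring_scope.

(* Configurations of {-1,1}^m are indexed by s : {ffun 'I_m -> bool}, where
   [true] stands for +1 and [false] for -1. *)
Definition spins (R : realType) (m : nat) (s : {ffun 'I_m -> bool}) : 'cV[R]_m :=
  \col_i (if s i then 1 else -1).

Definition ising_weight (R : realType) (m : nat) (J : 'M[R]_m) (h : 'cV[R]_m)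
    (s : {ffun 'I_m -> bool}) : R :=
  expR (((spins R s)^T *m J *m spins R s) ord0 ord0 / 2
        + (h^T *m spins R s) ord0 ord0).

Definition ising_pmf (R : realType) (m : nat) (J : 'M[R]_m) (h : 'cV[R]_m)
    (s : {ffun 'I_m -> bool}) : R :=
  ising_weight J h s / \sum_(t : {ffun 'I_m -> bool}) ising_weight J h t.

(* A random vector on (T, P) is the family x of its m coordinates.  The masses
   below sum to 1, so the law of x is determined (and x is in {-1,1}^m a.s.). *)
Definition follows_ising (d : measure_display) (T : measurableType d)
    (R : realType) (P : probability T R) (m : nat) (J : 'M[R]_m) (h : 'cV[R]_m)
    (x : 'I_m -> {RV P >-> R}) : Prop :=
  forall s : {ffun 'I_m -> bool},
    P [set w | forall i, x i w = spins R s i ord0] = (ising_pmf J h s)%:E.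

Definition norm_inf (R : realType) (m : nat) (J : 'M[R]_m) : R :=
  \big[Num.max/0]_(i < m) \sum_(j < m) `|J i j|.

Definition norm2 (R : realType) (m : nat) (a : 'cV[R]_m) : R :=
  Num.sqrt (\sum_(i < m) a i ord0 ^+ 2).

(* Elementary conditioning on an event A of positive probability. *)
Definition cond_expectation (d : measure_display) (T : measurableType d)
    (R : realType) (P : probability T R) (A : set T) (Y : T -> R) : R :=
  Rintegral P A Y / fine (P A).

Definition cond_variance (d : measure_display) (T : measurableType d)
    (R : realType) (P : probability T R) (A : set T) (Y : T -> R) : R :=
  cond_expectation P A (fun w => (Y w - cond_expectation P A Y) ^+ 2).

(* Var(x_i | x_{-i}) as a random variable: as x takes finitely many values
   almost surely, its value at w is the variance of x_i conditioned on the
   event that x_{-i} takes the value x_{-i}(w), which has positive probability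
   for almost every w. *)
Definition cond_variance_rest (d : measure_display) (T : measurableType d)
    (R : realType) (P : probability T R) (m : nat)
    (x : 'I_m -> {RV P >-> R}) (i : 'I_m) (w : T) : R :=
  cond_variance P [set w' | forall j, j != i -> x j w' = x j w] (x i).

Definition M_gamma_ising (d : measure_display) (T : measurableType d)
    (R : realType) (P : probability T R) (m : nat) (M gamma : R)
    (x : 'I_m -> {RV P >-> R}) : Prop :=
  exists (J : 'M[R]_m) (h : 'cV[R]_m),
    [/\ J^T = J,
        (forall i, J i i = 0),
        follows_ising J h x,
        norm_inf J <= M
      & {ae P, forall w, forall i, gamma <= cond_variance_rest x i w}].

(* Main.v *)
Require Import Defs.
From mathcomp Require Import all_boot all_order all_algebra.
From mathcomp Require Import all_classical all_reals all_analysis.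
From mathcomp Require Import ring lra.
Import measurable_realfun.
Import Order.TTheory GRing.Theory Num.Theory.
Set Implicit Arguments.
Unset Strict Implicit.
Unset Printing Implicit Defensive.
Local Open Scope classical_set_scope.
Local Open Scope ring_scope.

(** Let D_i = x_i - E[x_i | x_{-i}] and v_i = E[Var(x_i | x_{-i})].  The variance
    of a linear form a.x is bounded below by testing it against
    Y = sum_i a_i D_i.

    - D_i is orthogonal to every function of x_{-i}, and E[x_i D_i] = v_i.
      Hence Cov(a.x, Y) = sum_i a_i^2 v_i =: Q, however strongly the spins
      interact.
    - For i <> j, orthogonality means that E[D_i D_j] only sees how much D_j
      changes when the spin x_i is flipped.  In an Ising model D_j is a logistic
      function of the local field at j, which moves by 2 J_ij when x_i is
      flipped, so |E[D_i D_j]| <= 4 |J_ij| min(v_i, v_j).  Together with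
      E[D_i^2] = v_i this gives E[Y^2] <= (1 + 4 ||J||_inf) Q.

    Cauchy-Schwarz then yields Var(a.x) >= Q / (1 + 4 M), and Q >= gamma |a|^2.
    For m > 0 a spin has variance at most 1, so gamma <= 1; with gamma <= M this
    gives gamma / (1 + 4 M) >= gamma^2 / (5 M), and c = 1/5 works.

    All of this takes place on the hypercube with a positive weight p, where both
    facts about D_i are one identity, summation by parts along the edges
    {s, flip i s} ([residual_by_parts]); the bound for general weights is
    [variance_linear_ge], and [ising_variance_linear_ge] is its instance for
    Ising models.  The random vector enters through [integral_ising], which turns
    integrals over the probability space into sums over configurations. *)

(** * Spin flips on the hypercube *)

Definition spin (R : realType) (b : bool) : R := if b then 1 else -1.

Definition flip (m : nat) (i : 'I_m) (s : {ffun 'I_m -> bool}) :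
    {ffun 'I_m -> bool} :=
  [ffun j => if j == i then ~~ s j else s j].

Section Flip.
Variables (R : realType) (m : nat).
Implicit Types (i j : 'I_m) (s : {ffun 'I_m -> bool}).

Lemma spinN b : spin R (~~ b) = - spin R b.
Proof. by case: b; rewrite /spin /= ?opprK. Qed.

Lemma spin_sqr b : spin R b * spin R b = 1.
Proof. by case: b; rewrite /spin; ring. Qed.

Lemma normr_spin b : `|spin R b| = 1.
Proof. by case: b; rewrite /spin ?normrN normr1. Qed.

Lemma flip_at i s : flip i s i = ~~ s i.
Proof. by rewrite ffunE eqxx. Qed.

Lemma flip_neq i j s : j != i -> flip i s j = s j.
Proof. by move=> ji; rewrite ffunE (negbTE ji). Qed.

Lemma flipK i : involutive (flip i).
Proof.
by move=> s; apply/ffunP => j; rewrite !ffunE; case: eqP => // _; rewrite negbK.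
Qed.

Lemma sum_flip i (F : {ffun 'I_m -> bool} -> R) :
  \sum_s F (flip i s) = \sum_s F s.
Proof. by rewrite [RHS](reindex_inj (inv_inj (flipK i))). Qed.

End Flip.

(** * Residuals of a positive weight on the hypercube *)

Section Residuals.
Variables (R : realType) (m : nat) (p : {ffun 'I_m -> bool} -> R).
Hypothesis p_gt0 : forall s, 0 < p s.
Implicit Types (i j : 'I_m) (s : {ffun 'I_m -> bool}).

(** The value at [s] of x_i - E[x_i | x_{-i}] under the weight [p]: given x_{-i},
    the configuration is [s] or [flip i s], so the conditional mean is
    spin (s i) (p s - p (flip i s)) / (p s + p (flip i s)). *)
Definition residual i s : R :=
  2 * spin R (s i) * p (flip i s) / (p s + p (flip i s)).

(** Up to the factor 2, the conductance of the edge {s, flip i s} in heat-bath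
    Glauber dynamics; also [p s * residual i s] up to the sign [spin R (s i)]. *)
Definition conductance i s : R :=
  2 * p s * p (flip i s) / (p s + p (flip i s)).

Lemma edge_mass_neq0 i s : p s + p (flip i s) != 0.
Proof. by rewrite gt_eqF// addr_gt0. Qed.

Lemma conductance_ge0 i s : 0 <= conductance i s.
Proof. by rewrite /conductance divr_ge0 ?addr_ge0 ?mulr_ge0 ?ltW. Qed.

Lemma conductance_flip i s : conductance i (flip i s) = conductance i s.
Proof. by rewrite /conductance flipK addrC; congr (_ / _); ring. Qed.

(** Summation by parts: [p s * residual i s] is the conductance, which is constant
    on the edge {s, flip i s}, times a sign that is opposite at its two ends.
    Pairing the ends leaves only the increments of [F] along the edges. *)
Lemma residual_by_parts i (F : {ffun 'I_m -> bool} -> R) :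
  \sum_s p s * residual i s * F s =
  2^-1 * \sum_s conductance i s * (spin R (s i) * (F s - F (flip i s))).
Proof.
have E s : p s * residual i s * F s = conductance i s * spin R (s i) * F s.
  by rewrite /residual /conductance; ring.
rewrite (eq_bigr _ (fun s _ => E s)).
set G := fun s => conductance i s * spin R (s i) * F s.
rewrite -[LHS]/(\sum_s G s); apply: (mulfI (x := 2)); first by rewrite pnatr_eq0.
rewrite mulVKf ?pnatr_eq0// mulr_natl mulr2n -{2}(sum_flip (R := R) i) -big_split.
apply: eq_bigr => s _; rewrite /G /= conductance_flip flip_at spinN; ring.
Qed.

Lemma residual_jump i s :
  spin R (s i) * (residual i s - residual i (flip i s)) = 2.
Proof.
rewrite /residual flipK flip_at spinN (addrC (p (flip i s))).
transitivity (2 * (spin R (s i) * spin R (s i))); last by rewrite spin_sqr mulr1.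
by field; exact: edge_mass_neq0.
Qed.

(** E[Var(x_i | x_{-i})]: the edge {s, flip i s} has mass p s + p (flip i s) and
    conditional variance 4 p s p (flip i s) / (p s + p (flip i s))^2, and it
    occurs twice in the sum, once for each end. *)
Definition mean_cond_var i : R := \sum_s conductance i s.

Lemma mean_cond_var_ge0 i : 0 <= mean_cond_var i.
Proof. by apply: sumr_ge0 => s _; exact: conductance_ge0. Qed.

Lemma sum_residual_invariant i (F : {ffun 'I_m -> bool} -> R) :
  (forall s, F (flip i s) = F s) -> \sum_s p s * residual i s * F s = 0.
Proof.
move=> Fi; rewrite residual_by_parts big1 ?mulr0// => s _.
by rewrite Fi subrr !mulr0.
Qed.

Lemma sum_residual_spin i :
  \sum_s p s * residual i s * spin R (s i) = mean_cond_var i.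
Proof.
rewrite residual_by_parts mulr_sumr; apply: eq_bigr => s _.
by rewrite flip_at spinN opprK mulrDr spin_sqr; field.
Qed.

Lemma sum_residual_sqr i :
  \sum_s p s * residual i s * residual i s = mean_cond_var i.
Proof.
rewrite residual_by_parts mulr_sumr; apply: eq_bigr => s _.
by rewrite residual_jump; field.
Qed.

(** The covariance of two residuals is controlled by taking for [F] the residual
    at another site: weak influence of site [i] on that site makes it small. *)
Lemma sum_residual_le i (F : {ffun 'I_m -> bool} -> R) (k : R) :
  (forall s, `|F s - F (flip i s)| <= 2 * k) ->
  `|\sum_s p s * residual i s * F s| <= k * mean_cond_var i.
Proof.
move=> Fk; rewrite residual_by_parts normrM ger0_norm ?invr_ge0//.
rewrite -ler_pdivlMl ?invr_gt0// invrK mulr_sumr mulr_sumr.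
apply: (le_trans (ler_norm_sum _ _ _)); apply: ler_sum => s _.
rewrite normrM ger0_norm ?conductance_ge0// normrM normr_spin mul1r.
apply: le_trans (ler_wpM2l (conductance_ge0 i s) (Fk s)) _.
by rewrite le_eqVlt; apply/orP; left; apply/eqP; ring.
Qed.

(** The linear form X is compared with the combination Y of residuals with the
    same coefficients: their covariance is Q, while the second moment of Y is at
    most (1 + L) Q.  Expanding the second moment of X - Y / (1 + L), which is
    nonnegative, gives the bound; [mu] is arbitrary because residuals have mean
    zero. *)
Lemma variance_linear_ge (K : 'I_m -> 'I_m -> R) (L : R)
    (a : 'I_m -> R) (mu : R) :
  (forall i j, K i j = K j i) -> (forall i j, 0 <= K i j) ->
  (forall i j s, j != i ->
     `|residual j s - residual j (flip i s)| <= 2 * K i j) ->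
  (forall i, \sum_j K i j <= L) -> 0 <= L ->
  (1 + L)^-1 * \sum_i a i ^+ 2 * mean_cond_var i <=
  \sum_s p s * (\sum_i a i * spin R (s i) - mu) ^+ 2.
Proof.
move=> Ksym K0 Kinfl KL L0.
pose X s := \sum_i a i * spin R (s i) - mu.
pose Y s := \sum_i a i * residual i s.
set Q := \sum_i a i ^+ 2 * mean_cond_var i.
have aE i : 0 <= a i ^+ 2 * mean_cond_var i.
  by rewrite mulr_ge0 ?sqr_ge0 ?mean_cond_var_ge0.
have XY : \sum_s p s * X s * Y s = Q.
  under eq_bigr do rewrite /Y mulr_sumr.
  rewrite exchange_big /=; apply: eq_bigr => i _.
  transitivity (a i * (\sum_s p s * residual i s * (a i * spin R (s i)) +
      \sum_s p s * residual i s * (\sum_(j | j != i) a j * spin R (s j) - mu))).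
    rewrite -big_split/= mulr_sumr; apply: eq_bigr => s _.
    by rewrite /X (bigD1 i)//=; ring.
  (* the spins at the other sites and mu are invariant under flip i *)
  rewrite [X in _ + X]sum_residual_invariant ?addr0.
    rewrite -sum_residual_spin expr2 -mulrA; congr (_ * _).
    by rewrite mulr_sumr; apply: eq_bigr => s _; ring.
  by move=> s; congr (_ - _); apply: eq_bigr => j ji; rewrite flip_neq.
have YY : \sum_s p s * Y s ^+ 2 <= (1 + L) * Q.
  pose C i j := \sum_s p s * residual i s * residual j s.
  have Csym i j : C i j = C j i by apply: eq_bigr => s _; ring.
  have Coff i j : j != i -> `|C i j| <= K i j * mean_cond_var i.
    by move=> ji; apply: sum_residual_le => s; exact: Kinfl.
  have -> : \sum_s p s * Y s ^+ 2 = \sum_i \sum_j a i * a j * C i j.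
    under eq_bigr do rewrite expr2 /Y mulr_suml mulr_sumr.
    rewrite exchange_big/=; apply: eq_bigr => i _.
    under eq_bigr do rewrite mulr_sumr mulr_sumr.
    rewrite exchange_big/=; apply: eq_bigr => j _.
    by rewrite mulr_sumr; apply: eq_bigr => s _; ring.
  (* C i j is bounded through site i and, by symmetry, through site j; using
     both sides keeps each a_i^2 paired with the conditional variance at i *)
  have term i j : j != i -> a i * a j * C i j <=
      2^-1 * (K i j * (a i ^+ 2 * mean_cond_var i)) +
      2^-1 * (K j i * (a j ^+ 2 * mean_cond_var j)).
    move=> ji; apply: (le_trans (ler_norm _)); rewrite normrM.
    have h1 := Coff _ _ ji.
    have h2 : `|C i j| <= K j i * mean_cond_var j by rewrite Csym Coff // eq_sym.
    have c0 := normr_ge0 (C i j).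
    have := ler_wpM2l (sqr_ge0 (a i)) h1; have := ler_wpM2l (sqr_ge0 (a j)) h2.
    have : `|a i * a j| <= 2^-1 * a i ^+ 2 + 2^-1 * a j ^+ 2.
      have := sqr_ge0 (a i - a j); have := sqr_ge0 (a i + a j).
      by rewrite ler_norml => ? ?; apply/andP; split; lra.
    by move=> /(ler_wpM2r c0); lra.
  have KQ i : \sum_j K i j * (a i ^+ 2 * mean_cond_var i) <=
      L * (a i ^+ 2 * mean_cond_var i).
    rewrite -mulr_suml; apply: ler_wpM2r; last exact: KL.
    exact: aE.
  pose W := \sum_i \sum_j K i j * (a i ^+ 2 * mean_cond_var i).
  have WL : W <= L * Q by rewrite mulr_sumr; apply: ler_sum.
  rewrite mulrDl mul1r; apply: le_trans (lerD (lexx Q) WL).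
  have -> : W = \sum_i \sum_j (2^-1 * (K i j * (a i ^+ 2 * mean_cond_var i)) +
      2^-1 * (K j i * (a j ^+ 2 * mean_cond_var j))).
    transitivity (2^-1 * W + 2^-1 * W); first by field.
    rewrite {2}/W exchange_big /W /= !mulr_sumr -big_split; apply: eq_bigr => i _.
    by rewrite /= !mulr_sumr -big_split.
  rewrite -big_split; apply: ler_sum => i _ /=.
  rewrite (bigD1 i)//= lerD//.
    by rewrite /C sum_residual_sqr expr2.
  rewrite [leRHS](bigD1 i)//= -[leLHS]add0r lerD//.
    by rewrite addr_ge0// mulr_ge0 ?invr_ge0// mulr_ge0.
  by apply: ler_sum => j ji; exact: term.
set l := (1 + L)^-1.
have lL : l * (1 + L) = 1 by rewrite mulVf// gt_eqF// ltr_pwDl.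
have : 0 <= \sum_s p s * (X s - l * Y s) ^+ 2.
  by apply: sumr_ge0 => s _; rewrite mulr_ge0 ?sqr_ge0 ?ltW.
have -> : \sum_s p s * (X s - l * Y s) ^+ 2 =
    \sum_s p s * X s ^+ 2 - 2 * l * Q + l ^+ 2 * \sum_s p s * Y s ^+ 2.
  rewrite -XY !mulr_sumr -sumrB -big_split; apply: eq_bigr => s _ /=; ring.
have : l ^+ 2 * \sum_s p s * Y s ^+ 2 <= l * Q.
  apply: (le_trans (ler_wpM2l (sqr_ge0 l) YY)).
  by rewrite mulrA expr2 -(mulrA l) lL mulr1.
by rewrite -/(X _); lra.
Qed.

(** The hypothesis says that Var(x_i | x_{-i}) >= g on every edge. *)
Lemma mean_cond_var_ge i g :
  (forall s, g * (p s + p (flip i s)) ^+ 2 <= 4 * p s * p (flip i s)) ->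
  g * \sum_s p s <= mean_cond_var i.
Proof.
move=> H.
have -> : g * \sum_s p s = \sum_s g * (p s + p (flip i s)) / 2.
  by rewrite -mulr_suml -mulr_sumr big_split/= (sum_flip (R := R)); field.
rewrite /mean_cond_var; apply: ler_sum => s _.
rewrite /conductance ler_pdivlMr ?addr_gt0//.
by have := H s; lra.
Qed.

End Residuals.

(** * The Ising weight *)

(** The increment is (e^y - e^x) / ((1 + e^x) (1 + e^y)), and
    e^y - e^x <= e^y (y - x) because 1 + (x - y) <= e^(x - y).  The constant 1 is
    not optimal (1/4 is) but affects only the universal constant. *)
Lemma logistic_sub_le (R : realType) (x y : R) : x <= y ->
  0 <= (1 + expR x)^-1 - (1 + expR y)^-1 <= y - x.
Proof.
move=> xy.
have a0 := expR_gt0 x; have b0 := expR_gt0 y.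
have ab : expR x <= expR y by rewrite ler_expR.
have h : expR y - expR x <= expR y * (y - x).
  have := ler_wpM2l (ltW b0) (expR_ge1Dx (x - y)).
  by rewrite -expRD (_ : y + (x - y) = x); [lra|ring].
have -> : (1 + expR x)^-1 - (1 + expR y)^-1 =
    (expR y - expR x) / ((1 + expR x) * (1 + expR y)).
  by field; rewrite !gt_eqF// addr_gt0.
have ? : 0 < (1 + expR x) * (1 + expR y) by rewrite mulr_gt0 ?addr_gt0.
apply/andP; split; first by rewrite divr_ge0 ?subr_ge0// ltW.
rewrite ler_pdivrMr//; apply: (le_trans h).
rewrite -subr_ge0.
have -> : (y - x) * ((1 + expR x) * (1 + expR y)) - expR y * (y - x) =
  (y - x) * (1 + expR x + expR x * expR y) by ring.
by rewrite mulr_ge0 ?subr_ge0// !addr_ge0 ?mulr_ge0// ltW.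
Qed.

Lemma logistic_lipschitz (R : realType) (x y : R) :
  `|(1 + expR x)^-1 - (1 + expR y)^-1| <= `|x - y|.
Proof.
wlog xy : x y / x <= y => [H|].
  have [|/ltW] := leP x y; first exact: H.
  by move=> /H; rewrite distrC (distrC y).
have /andP[h0 h1] := logistic_sub_le xy.
by rewrite ger0_norm// distrC ger0_norm ?subr_ge0.
Qed.

Section Ising.
Variables (R : realType) (m : nat) (J : 'M[R]_m) (h : 'cV[R]_m).
Implicit Types (i j : 'I_m) (s : {ffun 'I_m -> bool}).

Lemma spinsE s i : spins R s i ord0 = spin R (s i).
Proof. by rewrite mxE. Qed.

Lemma spins_flip i s :
  spins R (flip i s) = spins R s - (2 * spin R (s i)) *: delta_mx i ord0.
Proof.
apply/matrixP => j k; rewrite (ord1 k) !mxE eqxx andbT ffunE.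
case: eqVneq => [->|_]; last by rewrite mulr0 subr0.
by case: (s i); rewrite /spin /=; ring.
Qed.

(** Half the change of log-likelihood when site [i] is flipped, up to the sign of
    the spin ([ising_pmf_flip]). *)
Definition local_field s i : R := (J *m spins R s + h) i ord0.

Lemma local_field_flip i j s :
  local_field s j - local_field (flip i s) j = 2 * spin R (s i) * J j i.
Proof.
by rewrite /local_field spins_flip mulmxBr -scalemxAr -colE !mxE; ring.
Qed.

Lemma ising_weight_gt0 s : 0 < ising_weight J h s.
Proof. exact: expR_gt0. Qed.

Lemma partition_function_gt0 : 0 < \sum_t ising_weight J h t.
Proof.
rewrite (bigD1 [ffun=> true])//= ltr_pwDl ?ising_weight_gt0//.
by apply: sumr_ge0 => s _; exact/ltW/ising_weight_gt0.
Qed.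

Lemma ising_pmf_gt0 s : 0 < ising_pmf J h s.
Proof. exact/divr_gt0/partition_function_gt0/ising_weight_gt0. Qed.

Lemma sum_ising_pmf : \sum_s ising_pmf J h s = 1.
Proof. by rewrite -mulr_suml mulfV// gt_eqF// partition_function_gt0. Qed.

Hypothesis J_sym : J^T = J.
Hypothesis J_diag : forall i, J i i = 0.

(** With u' = u - 2 s_i e_i, symmetry of J makes the two cross terms of the
    quadratic form equal, and the zero diagonal kills the square term. *)
Lemma ising_pmf_flip i s :
  ising_pmf J h s =
  ising_pmf J h (flip i s) * expR (2 * spin R (s i) * local_field s i).
Proof.
rewrite /ising_pmf mulrAC; congr (_ / _); rewrite /ising_weight -expRD.
congr expR; rewrite /local_field spins_flip.
set u := spins R s; set c := 2 * _; set e := delta_mx i ord0.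
have eB (B : 'cV[R]_m) : (e^T *m B) ord0 ord0 = B i ord0.
  by rewrite trmx_delta -rowE mxE.
have ueJ : (u^T *m J *m e) ord0 ord0 = (J *m u) i ord0.
  rewrite (_ : u^T *m J = (J *m u)^T); first by rewrite -colE [LHS]mxE mxE.
  by rewrite trmx_mul J_sym.
have heh : (h^T *m e) ord0 ord0 = h i ord0 by rewrite -colE !mxE.
have eJe : (e^T *m J *m e) ord0 ord0 = 0 by rewrite -mulmxA eB -colE mxE J_diag.
have eJu : (e^T *m J *m u) ord0 ord0 = (J *m u) i ord0 by rewrite -mulmxA eB.
have -> : (u - c *: e)^T = u^T - c *: e^T by rewrite linearB linearZ.
rewrite !(mulmxBl, mulmxBr) -?(scalemxAl, scalemxAr).
set Q := (u^T *m J *m u); set A := h^T *m u.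
have E1 (X Y Z W : 'M[R]_1) : (X - Y - (Z - W)) ord0 ord0 =
    X ord0 ord0 - Y ord0 ord0 - Z ord0 ord0 + W ord0 ord0 by rewrite !mxE; ring.
have E2 (k : R) (X : 'M[R]_1) : (k *: X) ord0 ord0 = k * X ord0 ord0
  by rewrite mxE.
have E3 (X Y : 'M[R]_1) : (X - Y) ord0 ord0 = X ord0 ord0 - Y ord0 ord0
  by rewrite !mxE.
have E4 (X Y : 'cV[R]_m) : (X + Y) i ord0 = X i ord0 + Y i ord0 by rewrite mxE.
by rewrite E1 E3 E4 !E2 ueJ eJu eJe heh; field.
Qed.

Lemma residual_ising i s :
  residual (ising_pmf J h) i s =
  2 * spin R (s i) * (1 + expR (2 * spin R (s i) * local_field s i))^-1.
Proof.
rewrite /residual {1}(ising_pmf_flip i s) -mulrA; congr (_ * _).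
move: (ising_pmf _ _ _) (ising_pmf_gt0 (flip i s)) => p p0.
by field; rewrite !gt_eqF ?addr_gt0 ?mulr_gt0 ?expR_gt0.
Qed.

(** A flip at [i] moves the local field at [j] by 2 J_ij, and the residual at [j]
    depends on the rest of the configuration only through that field. *)
Lemma residual_ising_influence i j s : j != i ->
  `|residual (ising_pmf J h) j s - residual (ising_pmf J h) j (flip i s)|
  <= 2 * (4 * `|J i j|).
Proof.
move=> ji; rewrite !residual_ising flip_neq//.
have Jij : J i j = J j i by rewrite -[in LHS]J_sym mxE.
rewrite -mulrBr normrM normrM normr_spin normr_nat mulr1 ler_pM2l//.
apply: (le_trans (logistic_lipschitz _ _)).
rewrite -mulrBr local_field_flip !normrM !normr_spin !normr_nat Jij.
by rewrite !mulr1 mulrA -natrM.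
Qed.

Lemma row_sum_le_norm_inf i : \sum_j `|J i j| <= norm_inf J.
Proof. exact: (le_bigmax _ (fun i => \sum_j `|J i j|)). Qed.

Lemma ising_variance_linear_ge (M : R) (a : 'I_m -> R) (mu : R) :
  0 <= M -> norm_inf J <= M ->
  (1 + 4 * M)^-1 * \sum_i a i ^+ 2 * mean_cond_var (ising_pmf J h) i <=
  \sum_s ising_pmf J h s * (\sum_i a i * spin R (s i) - mu) ^+ 2.
Proof.
move=> M0 JM; apply: (variance_linear_ge ising_pmf_gt0 _ _
  (K := fun i j => 4 * `|J i j|)).
- by move=> i j; rewrite -[in LHS]J_sym mxE.
- by move=> i j; rewrite mulr_ge0.
- by move=> i j s; exact: residual_ising_influence.
- move=> i; rewrite -mulr_sumr ler_pM2l//.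
  exact: le_trans (row_sum_le_norm_inf i) JM.
- by rewrite mulr_ge0.
Qed.

End Ising.

(** * From the probability space to the hypercube *)

(** The cells carry the whole mass, so almost everywhere [f] is the step function
    with value [G s] on the cell [E s]; [D] is, up to a null set, the union of the
    cells selected by [B]. *)
Lemma integral_cells (d : measure_display) (T : measurableType d)
    (R : realType) (P : probability T R) (I : finType) (E : I -> set T)
    (p : I -> R) (D : set T) (B : pred I) (f : T -> R) (G : I -> R) :
  (forall s, measurable (E s)) ->
  (forall s t w, E s w -> E t w -> s = t) ->
  (forall s, P (E s) = (p s)%:E) -> \sum_s p s = 1 ->
  measurable D -> (forall s w, E s w -> D w <-> B s) ->
  measurable_fun setT f -> (forall s w, E s w -> f w = G s) ->
  (\int[P]_(w in D) (f w)%:E)%E = (\sum_(s | B s) p s * G s)%:E.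
Proof.
move=> mE dE PE p1 mD DB mf fG.
pose g s : T -> R := fun w => G s * \1_(E s) w.
have mI s : measurable_fun D (\1_(E s) : T -> R) by exact: measurable_indic.
have mind s : measurable_fun D (EFin \o g s).
  apply/measurable_EFinP; exact: measurable_funM.
have PU : P (\bigcup_s E s) = 1%E.
  rewrite measure_fin_bigcup//; first last.
  - by move=> s t _ _ [w [Es Et]]; exact: dE Es Et.
  - exact: finite_finset.
  rewrite (fsbigE (index_enum I)) ?index_enum_uniq//; last first.
    by move=> s _; rewrite mem_index_enum.
  under eq_bigl do rewrite in_setT.
  by rewrite (eq_bigr _ (fun s _ => PE s)) sumEFin p1.
have mU : measurable (\bigcup_s E s) by apply: fin_bigcup_measurable.
have indE s w t : E t w -> (\1_(E s) w : R) = (s == t)%:R.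
  move=> Et; rewrite indicE; congr (_%:R); congr nat_of_bool.
  apply/idP/eqP => [|->]; last by rewrite inE.
  by rewrite inE => Es; exact: dE Es Et.
transitivity (\int[P]_(w in D) (\sum_s (g s w)%:E))%E.
  apply: ae_eq_integral => //.
  - by apply/measurable_EFinP; exact: measurable_funTS.
  - by apply: emeasurable_sum.
  - exists (~` \bigcup_s E s); split; first exact: measurableC.
      by apply: (etrans (probability_setC P mU)); rewrite PU subee.
    move=> w /= H [t _ Et]; apply: H => _.
    rewrite sumEFin /g (fG _ _ Et) (bigD1 t)//= big1 => [|s st].
      by rewrite (indE _ _ _ Et) eqxx mulr1 addr0.
    by rewrite (indE _ _ _ Et) (negbTE st) mulr0.
have intI s : P.-integrable D (fun w => (\1_(E s) w : R)%:E).
  apply/integrableP; split; first by apply/measurable_EFinP; exact: mI.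
  under eq_integral do rewrite gee0_abs ?lee_fin//.
  rewrite integral_indic//; apply: le_lt_trans (probability_le1 _ _) _.
    exact: measurableI.
  by rewrite ltry.
rewrite integral_sum//; last first.
  move=> s.
  have -> : (fun w => (g s w)%:E) = (fun w => ((G s)%:E * (\1_(E s) w)%:E)%E).
    by apply/funext => w; rewrite EFinM.
  exact: integrableZl.
rewrite -sumEFin big_mkcond [RHS]big_mkcond; apply: eq_bigr => s _ /=.
under eq_integral do rewrite /g EFinM.
rewrite integralZl//.
rewrite integral_indic//; case: ifPn => Bs.
  have -> : (E s `&` D = E s)%classic.
    by rewrite setIidl// => w Es; exact/(DB _ _ Es).
  by apply: (etrans (congr1 (mule (G s)%:E) (PE s))); rewrite -EFinM mulrC.
have -> : (E s `&` D = set0)%classic.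
  by rewrite -subset0 => w [Es]; rewrite (DB _ _ Es) (negbTE Bs).
by rewrite measure0 mule0.
Qed.

Section IsingVector.
Context (d : measure_display) (T : measurableType d) (R : realType).
Context (P : probability T R) (m : nat) (J : 'M[R]_m) (h : 'cV[R]_m).
Context (x : 'I_m -> {RV P >-> R}).
Implicit Types (i j : 'I_m) (s t : {ffun 'I_m -> bool}).
Hypothesis x_ising : follows_ising J h x.

Definition cell s : set T := [set w | forall i, x i w = spins R s i ord0].

Lemma measurable_agree (Q : pred 'I_m) (v : 'I_m -> R) :
  measurable [set w | forall j, Q j -> x j w = v j].
Proof.
rewrite (_ : [set _ | _] = \bigcap_(j in [set j | Q j]) (x j @^-1` [set v j])).
  apply: fin_bigcap_measurable => [|j _]; first exact: finite_finset.
  by rewrite -[X in measurable X]setTI; exact: measurable_funP.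
by apply/seteqP; split.
Qed.

Lemma measurable_cell s : measurable (cell s).
Proof.
rewrite (_ : cell s = [set w | forall j, xpredT j -> x j w = spins R s j ord0]).
  exact: measurable_agree.
by apply/seteqP; split => w /= H j => [_|]; exact: H.
Qed.

Lemma spin_inj : injective (spin R).
Proof. by case=> [] [] //; rewrite /spin => ?; lra. Qed.

Lemma cell_inj s t w : cell s w -> cell t w -> s = t.
Proof.
move=> sw tw; apply/ffunP => i; apply: spin_inj.
by rewrite -!spinsE -(sw i) -(tw i).
Qed.

Lemma integral_ising (D : set T) (B : pred {ffun 'I_m -> bool}) (f : T -> R)
    (G : {ffun 'I_m -> bool} -> R) :
  measurable D -> (forall s w, cell s w -> D w <-> B s) ->
  measurable_fun setT f -> (forall s w, cell s w -> f w = G s) ->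
  (\int[P]_(w in D) (f w)%:E)%E = (\sum_(s | B s) ising_pmf J h s * G s)%:E.
Proof.
apply: integral_cells; [exact: measurable_cell|exact: cell_inj|exact: x_ising|].
exact: sum_ising_pmf.
Qed.

Lemma sum_edge i s (G : {ffun 'I_m -> bool} -> R) :
  \sum_(t | (t == s) || (t == flip i s)) G t = G s + G (flip i s).
Proof.
have fs : flip i s != s.
  by apply/eqP => /ffunP /(_ i); rewrite flip_at; case: (s i).
rewrite (bigD1 s) ?eqxx//=; congr (_ + _); apply: big_pred1 => t /=.
by case: (eqVneq t s) => [->|]; rewrite ?andbT ?andbF// eq_sym (negbTE fs).
Qed.

(** The event on which one conditions at site [i] is, up to a null set, the union
    of the two cells at the ends of the edge {s, flip i s}. *)
Lemma agree_off_cell i s t w w' : cell s w -> cell t w' ->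
  (forall j, j != i -> x j w' = x j w) <-> (t == s) || (t == flip i s).
Proof.
move=> sw tw; split=> [H|/orP[] /eqP ts j ji].
- have st j : j != i -> t j = s j.
    by move=> /H; rewrite sw tw !spinsE => /spin_inj.
  case: (eqVneq (t i) (s i)) => [e|ne].
    apply/orP; left; apply/eqP/ffunP => j.
    by case: (eqVneq j i) => [->//|/st].
  apply/orP; right; apply/eqP/ffunP => j; rewrite ffunE.
  by case: (eqVneq j i) => [->|/st//]; move: ne; case: (t i); case: (s i).
- by rewrite sw tw ts.
- by rewrite sw tw ts !spinsE flip_neq.
Qed.

Lemma cond_expectation_edge i s w (f : T -> R) (G : {ffun 'I_m -> bool} -> R) :
  cell s w -> measurable_fun setT f -> (forall t w, cell t w -> f w = G t) ->
  cond_expectation P [set w' | forall j, j != i -> x j w' = x j w] f =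
  (ising_pmf J h s * G s + ising_pmf J h (flip i s) * G (flip i s)) /
  (ising_pmf J h s + ising_pmf J h (flip i s)).
Proof.
move=> sw mf fG; rewrite /cond_expectation /Rintegral.
set D := [set _ | _].
have mD : measurable D by exact: measurable_agree.
have DB t w' : cell t w' -> D w' <-> (t == s) || (t == flip i s).
  by move=> tw; exact: agree_off_cell.
rewrite (integral_ising mD DB mf fG) sum_edge/=; congr (_ / _).
have PD : P D = (ising_pmf J h s + ising_pmf J h (flip i s))%:E.
  transitivity (\int[P]_(w in D) cst 1%E w)%E.
    by rewrite integral_cst// mul1e.
  have := integral_ising mD DB (measurable_cst (1 : R)) (G := fun=> 1)
    (fun _ _ _ => erefl).
  by rewrite sum_edge !mulr1; apply: etrans.
by rewrite PD.
Qed.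

Lemma cond_variance_rest_cell i s w : cell s w ->
  cond_variance_rest x i w =
  4 * ising_pmf J h s * ising_pmf J h (flip i s) /
  (ising_pmf J h s + ising_pmf J h (flip i s)) ^+ 2.
Proof.
move=> sw; rewrite /cond_variance_rest /cond_variance.
have mx : measurable_fun setT (x i) by exact: measurable_funP.
have xG t w' : cell t w' -> x i w' = spin R (t i).
  by move=> tw; rewrite tw spinsE.
rewrite (cond_expectation_edge i sw mx xG) flip_at spinN.
set mu := _ / _.
rewrite (cond_expectation_edge (G := fun t => (spin R (t i) - mu) ^+ 2) i sw).
- rewrite flip_at spinN /mu.
  have p0 := ising_pmf_gt0 J h s; have q0 := ising_pmf_gt0 J h (flip i s).
  set p := ising_pmf J h s in p0 *; set q := ising_pmf J h (flip i s) in q0 *.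
  have pq : p + q != 0 by rewrite gt_eqF// addr_gt0.
  by case: (s i); rewrite /spin; field.
- by apply: measurable_funX; exact: measurable_funB.
- by move=> t w' tw; rewrite (xG t).
Qed.

(** Every configuration has positive probability, so an almost sure property
    holds somewhere on each cell.  This turns the almost sure lower bound on
    conditional variances into one at every configuration. *)
Lemma ae_cell (Q : T -> Prop) s : {ae P, forall w, Q w} ->
  exists2 w, cell s w & Q w.
Proof.
move=> [N [mN PN QN]]; apply: contrapT => H.
have sN : cell s `<=` N.
  by move=> w sw; apply: QN => Qw; apply: H; exists w.
have : (P (cell s) <= P N)%E.
  by apply: le_measure; rewrite ?inE//; exact: measurable_cell.
rewrite (x_ising s) (PN : P N = 0%E) lee_fin.
by rewrite leNgt ising_pmf_gt0.
Qed.

Lemma variance_ising (a : 'I_m -> R) : exists mu,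
  'V_P[fun w => (\sum_(i < m) a i * x i w)%R]%E =
  (\sum_s ising_pmf J h s * (\sum_i a i * spin R (s i) - mu) ^+ 2)%:E.
Proof.
pose X w : R := \sum_(i < m) a i * x i w.
exists (fine 'E_P[X]%E); set mu := fine _.
rewrite -/X /variance covariance.unlock -/mu expectation.unlock.
rewrite (integral_ising (B := xpredT)
  (G := fun s => (\sum_i a i * spin R (s i) - mu) ^+ 2))//.
- have mX : measurable_fun setT X.
    by apply: measurable_sum => i; exact: measurable_funM.
  by apply: measurable_funM; apply: measurable_funB.
- move=> s w sw; rewrite expr2 -[LHS]/((X w - mu) * (X w - mu)).
  rewrite (_ : X w = \sum_i a i * spin R (s i))//.
  by apply: eq_bigr => i _; rewrite sw spinsE.
Qed.

End IsingVector.

Theorem lemma6 (R : realType) :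
  exists c : R, 0 < c /\
    forall (d : measure_display) (T : measurableType d) (P : probability T R)
           (m : nat) (M gamma : R) (x : 'I_m -> {RV P >-> R}),
      0 < M -> 0 < gamma -> gamma <= M ->
      M_gamma_ising M gamma x ->
      forall a : 'cV[R]_m,
        ((c * gamma ^+ 2 * norm2 a ^+ 2 / M)%:E
           <= 'V_P[fun w => (\sum_(i < m) a i ord0 * x i w)%R])%E.
Proof.
exists (1 / 5); split; first by rewrite divr_gt0.
move=> d T P m M gamma x M0 g0 gM [J [h [Jsym Jdiag xI JM condvar]]] a.
have [mu ->] := variance_ising xI (fun i => a i ord0).
rewrite lee_fin.
have edge i s : gamma * (ising_pmf J h s + ising_pmf J h (flip i s)) ^+ 2 <=
    4 * ising_pmf J h s * ising_pmf J h (flip i s).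
  have [w sw /(_ i)] := ae_cell xI s condvar.
  rewrite (cond_variance_rest_cell xI i sw) ler_pdivlMr//.
  by rewrite exprn_gt0// addr_gt0// ising_pmf_gt0.
have gamma_le_mean_cond_var i : gamma <= mean_cond_var (ising_pmf J h) i.
  have := mean_cond_var_ge (ising_pmf_gt0 J h) (edge i).
  by rewrite sum_ising_pmf mulr1.
apply: le_trans (ising_variance_linear_ge h Jsym Jdiag _ mu (ltW M0) JM).
set N := \sum_(i < m) a i ord0 ^+ 2.
have N0 : 0 <= N by apply: sumr_ge0 => i _; exact: sqr_ge0.
have -> : norm2 a ^+ 2 = N by rewrite sqr_sqrtr.
apply: (@le_trans _ _ ((1 + 4 * M)^-1 * (gamma * N))); last first.
  apply: ler_wpM2l; first by rewrite invr_ge0 addr_ge0// mulr_ge0// ltW.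
  rewrite /N mulr_sumr; apply: ler_sum => i _.
  by rewrite mulrC ler_wpM2l ?sqr_ge0.
case: (posnP m) => [m0|m_gt0].
  suff -> : N = 0 by rewrite !(mulr0, mul0r).
  rewrite /N; move: a {mu edge gamma_le_mean_cond_var N N0}; subst m => a.
  by rewrite big_ord0.
(* gamma <= 1 because 4 p q <= (p + q)^2 on any one edge *)
have g1 : gamma <= 1.
  have := edge (Ordinal m_gt0) [ffun=> true].
  set p := ising_pmf J h _; set q := ising_pmf J h _ => E.
  have p0 : 0 < p by exact: ising_pmf_gt0.
  have q0 : 0 < q by exact: ising_pmf_gt0.
  rewrite -(ler_pM2r (x := (p + q) ^+ 2)) ?exprn_gt0 ?addr_gt0// mul1r.
  by apply: (le_trans E); have := sqr_ge0 (p - q); lra.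
have M4 : 0 < 1 + 4 * M by lra.
have gMM : gamma * M <= M by rewrite ler_piMl// ltW.
have -> : 1 / 5 * gamma ^+ 2 * N / M =
  (gamma * N) * (gamma * (1 + 4 * M)) / (5 * M * (1 + 4 * M)).
  by field; rewrite !gt_eqF.
rewrite (mulrC (1 + 4 * M)^-1) -mulrA; apply: ler_wpM2l.
  by rewrite mulr_ge0// ltW.
rewrite ler_pdivrMr ?mulr_gt0//.
rewrite [leRHS](_ : _ = 5 * M); last by field; rewrite gt_eqF.
lra.
Qed.
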